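(* For any tree $T$ of order at least three, $\mathrm{mob}(T\,\square\, K_2)=\ell(T)$, where $\ell(T)$ is the number of leaves of $T$.
   Context: A leaf is a vertex of degree one. $\square$ is the Cartesian product: vertex set $V(G)\times V(H)$, $(g,h)\sim(g',h')$ iff ($gg'\in E(G)$, $h=h'$) or ($g=g'$, $hh'\in E(H)$). A set $S\subseteq V(G)$ is a general position set if no three vertices of $S$ lie on a common shortest path. Robots are placed one per vertex of a general position set $S$; a move $u\to v$ along an edge $uv$ with $u\in S$ is legal if $v\notin S$ and $(S\setminus\{u\})\cup\{v\}$ is a general position set. $S$ is a mobile general position set if some sequence of legal moves starting from $S$ visits every vertex at least once; $\mathrm{mob}(G)$ is the maximum size of a mobile general position set. *)

(* Defs.v *)
From HB Require Import structures.
From mathcomp Require Import all_boot.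
From mathcomp Require Import boolp.

Set Implicit Arguments.
Unset Strict Implicit.
Unset Printing Implicit Defensive.

Record sgraph := SGraph {
  vertex :> finType;
  adj : rel vertex;
  adj_sym : symmetric adj;
  adj_irrefl : irreflexive adj }.

Section Graphs.
Variable G : sgraph.
Implicit Types (x y u v w : G) (p c : seq G) (A B S : {set G}).

Definition degree x := #|[set y | adj x y]|.

Definition num_leaves := #|[set x : G | degree x == 1]|.

Definition connected := forall x y, connect (@adj G) x y.

(* The bound on the size discards the closed walks [::] and [:: x; y], which
   satisfy ucycle but are not cycles of a simple graph. *)
Definition acyclic := forall c, 2 < size c -> ~ ucycle (@adj G) c.

Definition is_tree := connected /\ acyclic.

(* The path is x :: p, of length size p. *)
Definition shortest_path x p :=
  path (@adj G) x p /\
  forall q : seq G, path (@adj G) x q -> last x q = last x p -> size p <= size q.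

Definition general_position S :=
  forall u v w, u \in S -> v \in S -> w \in S -> uniq [:: u; v; w] ->
  ~ exists x p, shortest_path x p /\ {subset [:: u; v; w] <= x :: p}.

Definition legal_move A B :=
  exists u v, [/\ u \in A, adj u v, v \notin A,
                  B = v |: (A :\ u) & general_position B].

(* S :: Ss is the sequence of robot configurations; the vertices occupied
   initially count as visited. *)
Definition mobile S :=
  general_position S /\
  exists Ss : seq {set G},
    path (fun A B => `[< legal_move A B >]) S Ss /\
    forall x, exists2 A, A \in S :: Ss & x \in A.

Definition mob := \max_(S : {set G} | `[< mobile S >]) #|S|.

End Graphs.

Section Cartesian.
Variables G H : sgraph.

Definition cart_adj : rel (G * H) := fun a b =>
  (adj a.1 b.1 && (a.2 == b.2)) || ((a.1 == b.1) && adj a.2 b.2).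

Lemma cart_adj_sym : symmetric cart_adj.
Proof.
move=> a b; rewrite /cart_adj (adj_sym a.1) (adj_sym a.2).
by rewrite (eq_sym a.1) (eq_sym a.2).
Qed.

Lemma cart_adj_irrefl : irreflexive cart_adj.
Proof. by move=> a; rewrite /cart_adj !adj_irrefl andbF. Qed.

Definition cartesian := SGraph cart_adj_sym cart_adj_irrefl.

End Cartesian.

Section Complete.
Variable n : nat.

Definition complete_adj : rel 'I_n := fun i j => i != j.

Lemma complete_adj_sym : symmetric complete_adj.
Proof. by move=> i j; rewrite /complete_adj eq_sym. Qed.

Lemma complete_adj_irrefl : irreflexive complete_adj.
Proof. by move=> i; rewrite /complete_adj eqxx. Qed.

Definition complete := SGraph complete_adj_sym complete_adj_irrefl.

End Complete.

(* Main.v *)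
(** In the prism over a tree, [v] lies on a geodesic from [u] to [w] iff it does
    so after projection to the tree and is not alone in its layer among the
    three.

    Upper bound: a general position set of a tree has at most as many points as
    there are leaves, since one can choose a leaf beyond each point.  So if a
    general position set of the prism has more points, some [v] projects
    strictly between two others [u] and [w].  Then [v] is alone in its layer
    [i]: any further point is separated by [v] from [u] or from [w].  A legal
    move cannot change the layer [i], and [v], projecting between two others,
    never projects to a leaf; hence no vertex (leaf, [i]) is ever visited.

    Lower bound: put the robots on the leaves, all in one layer.  Leaves are
    never interior to a geodesic of the tree, so each robot may change layers,
    and a robot that is alone in its layer may roam over all inner vertices. *)

Require Import Defs.
From HB Require Import structures.
From mathcomp Require Import all_boot zify.
From mathcomp Require Import boolp.

Set Implicit Arguments.
Unset Strict Implicit.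
Unset Printing Implicit Defensive.

(** * Distance and betweenness in a connected graph *)

(** The graph distance is given by a specification, so that the prism can use an explicit formula in
    place of a minimum over walks. *)
Definition is_dist (G : sgraph) (d : G -> G -> nat) :=
  (forall x p, path (@adj G) x p -> d x (last x p) <= size p) /\
  (forall x y, exists p, [/\ path (@adj G) x p, last x p = y & size p = d x y]).

Lemma connected_is_dist (G : sgraph) : connected G -> exists d, @is_dist G d.
Proof.
move=> cG.
have ex x y : exists n,
    [exists p : n.-tuple G, path (@adj G) x p && (last x p == y)].
  have /connectP[p pp ->] := cG x y.
  by exists (size p); apply/existsP; exists (in_tuple p); rewrite pp eqxx.
exists (fun x y => ex_minn (ex x y)); split=> [x p pp|x y].
  case: ex_minnP => n _; apply.
  by apply/existsP; exists (in_tuple p); rewrite pp eqxx.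
case: ex_minnP => n /existsP[p /andP[pp /eqP lp]] _.
by exists p; rewrite size_tuple.
Qed.

Section Distance.
Variables (G : sgraph) (d : G -> G -> nat).
Hypothesis dG : is_dist d.
Implicit Types x y z u v w r : G.

Lemma dist_triangle x y z : d x z <= d x y + d y z.
Proof.
have [p [pp lp <-]] := dG.2 x y; have [q [pq lq <-]] := dG.2 y z.
rewrite -lq -lp -last_cat -size_cat; apply: dG.1.
by rewrite cat_path pp lp.
Qed.

Lemma distxx x : d x x = 0.
Proof. by apply/eqP; rewrite -leqn0; apply: (dG.1 x [::]). Qed.

Lemma dist_sym x y : d x y = d y x.
Proof.
suff le a b : d a b <= d b a by apply/eqP; rewrite eqn_leq !le.
have [p [pp lp <-]] := dG.2 b a.
have := dG.1 a (rev (belast b p)).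
rewrite -lp rev_path size_rev size_belast; set q := last _ (rev _).
have -> : q = b by rewrite /q; case: p {pp lp q} => // c p; rewrite [belast _ _]/= rev_cons last_rcons.
by apply; rewrite (eq_path (e' := @adj G)) // => u v; apply: adj_sym.
Qed.

Lemma dist_eq0 x y : d x y = 0 -> x = y.
Proof. by have [p [_ <- <-]] := dG.2 x y; case: p. Qed.

Lemma dist_gt0 x y : x != y -> 0 < d x y.
Proof. by rewrite lt0n; apply: contra_neq => /dist_eq0. Qed.

Lemma dist_adj x y : adj x y -> d x y = 1.
Proof.
move=> xy; apply/eqP; rewrite eqn_leq dist_gt0 ?andbT.
  by apply: (dG.1 x [:: y]); rewrite /= xy.
by apply: contraTneq xy => ->; rewrite adj_irrefl.
Qed.

Lemma dist_pred x y : x != y -> exists2 z, adj y z & d x y = (d x z).+1.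
Proof.
move=> xy; have [p [pp lp sp]] := dG.2 x y.
case/lastP: p pp lp sp => [|p z] pp lp sp; first by rewrite -lp eqxx in xy.
rewrite last_rcons in lp; rewrite -{y xy}lp in sp *.
move: pp; rewrite rcons_path => /andP[pp pz].
exists (last x p); first by rewrite adj_sym.
have := dG.1 x p pp; have := dist_triangle x (last x p) z.
by rewrite (dist_adj pz) -sp size_rcons; lia.
Qed.

(** Counting edges bounds every gap from above; a smaller gap anywhere would, by the triangle
    inequality, bring the ends closer than [size p]. *)
Lemma shortest_path_dist x p i j :
  shortest_path x p -> i <= j <= size p ->
  d (nth x (x :: p) i) (nth x (x :: p) j) = j - i.
Proof.
move=> [pp mp].
have up k l : k <= l <= size p ->
    d (nth x (x :: p) k) (nth x (x :: p) l) <= l - k.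
  elim: l => [|l IH]; first by rewrite leqn0 => /andP[/eqP-> _]; rewrite distxx.
  move=> /andP[]; rewrite leq_eqVlt => /orP[/eqP-> _|]; first by rewrite distxx.
  rewrite ltnS => kl lp; have := IH; rewrite kl (ltnW lp) => /(_ isT).
  have := dist_triangle (nth x (x :: p) k) (nth x (x :: p) l) (nth x p l).
  by have /(pathP x) := pp => /(_ l lp)/dist_adj ->; rewrite /=; lia.
have full : size p <= d x (last x p).
  by have [q [pq lq <-]] := dG.2 x (last x p); apply: mp.
move=> /andP[ij jp]; have := up i j; rewrite ij jp => /(_ isT).
have := up 0 i; rewrite (leq_trans ij jp) => /(_ isT).
have := up j (size p); rewrite jp leqnn => /(_ isT).
rewrite (last_nth x) in full; rewrite /= in full *.
set a := nth x (x :: p) i; set b := nth x (x :: p) j.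
set c := nth x (x :: p) _ in full *.
have := dist_triangle x a c; have := dist_triangle a b c; lia.
Qed.

Lemma general_positionP (S : {set G}) : general_position S <->
  forall u v w, u \in S -> v \in S -> w \in S -> uniq [:: u; v; w] ->
  d u w <> d u v + d v w.
Proof.
split=> [gp u v w uS vS wS uq duw | gp u v w uS vS wS uq [x [p [sp sub]]]].
  apply: (gp u v w uS vS wS uq).
  have [p [pp lp sp]] := dG.2 u v; have [q [pq lq sq]] := dG.2 v w.
  exists u, (p ++ q); split.
    split=> [|s ps]; first by rewrite cat_path pp lp.
    rewrite last_cat lp lq size_cat sp sq -duw => <-; exact: dG.1.
  move=> z; rewrite -cat_cons mem_cat !inE => /or3P[]/eqP->; first by rewrite eqxx.
    by rewrite -in_cons -lp mem_last.
  by have := mem_last v q; rewrite lq inE -{1}lp => /orP[/eqP->|->];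
     rewrite ?orbT // -in_cons mem_last.
(* Vertices of a shortest path are ordered by their position, and the middle one gives the forbidden
   equality. The six possible orders are then treated in turn. *)
have mid a b c : a \in S -> b \in S -> c \in S -> uniq [:: a; b; c] ->
    a \in x :: p -> b \in x :: p -> c \in x :: p ->
    index a (x :: p) <= index b (x :: p) <= index c (x :: p) -> False.
  move=> aS bS cS abc ap bp cp /andP[ab bc]; apply: (gp a b c aS bS cS abc).
  have cs : index c (x :: p) <= size p by rewrite -ltnS -/(size (x :: p)) index_mem.
  rewrite -(nth_index x ap) -(nth_index x bp) -(nth_index x cp).
  rewrite !(shortest_path_dist sp) ?ab ?bc ?(leq_trans ab bc) ?(leq_trans bc cs) //.
  by rewrite addnC addnBA // subnK.
have [up vp wp] : [/\ u \in x :: p, v \in x :: p & w \in x :: p].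
  by split; apply: sub; rewrite !inE eqxx ?orbT.
have [[uv vw] [uw [vu wv wu]]] :
    (u != v /\ v != w) /\ u != w /\ [/\ v != u, w != v & w != u].
  move: uq; rewrite /= !inE negb_or andbT => /andP[/andP[uv uw] vw].
  by rewrite (eq_sym v u) (eq_sym w v) (eq_sym w u).
have uq3 a b c : a != b -> a != c -> b != c -> uniq [:: a; b; c].
  by rewrite /= !inE negb_or => -> -> ->.
have [iuv|/ltnW ivu] := leqP (index u (x :: p)) (index v (x :: p)).
  have [ivw|/ltnW iwv] := leqP (index v (x :: p)) (index w (x :: p)).
    by apply: (mid u v w) => //; rewrite iuv ivw.
  have [iuw|/ltnW iwu] := leqP (index u (x :: p)) (index w (x :: p)).
    by apply: (mid u w v); rewrite ?uq3 ?iuw ?iwv.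
  by apply: (mid w u v); rewrite ?uq3 ?iwu ?iuv.
have [iuw|/ltnW iwu] := leqP (index u (x :: p)) (index w (x :: p)).
  by apply: (mid v u w); rewrite ?uq3 ?ivu ?iuw.
have [ivw|/ltnW iwv] := leqP (index v (x :: p)) (index w (x :: p)).
  by apply: (mid v w u); rewrite ?uq3 ?ivw ?iwu.
by apply: (mid w v u); rewrite ?uq3 ?iwv ?ivu.
Qed.

Lemma between_neq x y z : y != z -> d x z = d x y + d y z -> x != z.
Proof.
move=> yz e; apply/eqP=> xz; move: e; rewrite xz distxx.
by have := dist_gt0 yz; lia.
Qed.

Lemma between_antisym x y z :
  d x z = d x y + d y z -> d x y = d x z + d z y -> y = z.
Proof. by rewrite (dist_sym z) => e1 e2; apply: dist_eq0; lia. Qed.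

(** If [v] differs from both ends, its only neighbour is nearer than [v] to [u] and to [w], so a
    route through that neighbour saves 2. *)
Lemma leaf_not_between u v w :
  degree v = 1 -> d u w = d u v + d v w -> v = u \/ v = w.
Proof.
move=> /eqP/cards1P[z Nv] duw.
have [<-|uv] := eqVneq u v; first by left.
have [<-|wv] := eqVneq w v; first by right.
have Nz y : adj v y -> y = z.
  by move=> vy; apply/set1P; rewrite -Nv inE.
have [a /Nz-> du] := dist_pred uv; have [b /Nz-> dw] := dist_pred wv.
have := dist_triangle u z w; rewrite [d z w]dist_sym.
move: duw; rewrite [d v w]dist_sym; lia.
Qed.

End Distance.

(** * Betweenness and general position in trees *)

Section Tree.
Variables (T : sgraph) (d : T -> T -> nat).
Hypotheses (dT : is_dist d) (acT : acyclic T).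
Implicit Types a r s u v w x y z : T.

(** A simple path between distinct [z] and [z'] that avoids [x] would close up through [x] to a
    cycle. *)
Lemma acyclic_connect_neighbours x z z' :
  adj x z -> adj x z' ->
  connect (fun a b => [&& adj a b, a != x & b != x]) z z' -> z = z'.
Proof.
move=> xz xz' /connectP[p0 pp0 zp0]; rewrite {}zp0 in xz' *.
case/shortenP: pp0 xz' => p pp up _ xz' {p0}.
have zx : z != x by apply: contraTneq xz => ->; rewrite adj_irrefl.
have xp : x \notin p.
  elim: p z {up xz xz' zx} pp => //= b p IH a /andP[/and3P[_ _ bx] /IH].
  by rewrite inE negb_or eq_sym bx.
case: p => [//|b p] in pp up xz' xp *.
case: (acT (c := x :: z :: b :: p)) => //.
rewrite /ucycle; apply/andP; split.
  rewrite /= xz /= rcons_path /=; case/andP: (pp) => /and3P[-> _ _] pp' /=.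
  rewrite adj_sym xz' andbT; apply: sub_path pp' => ? ? /and3P[] //.
by rewrite cons_uniq up andbT inE negb_or eq_sym zx.
Qed.

(** Along a geodesic from [z] to [r] the distance to [r] drops below [d r x] after one step, so [x]
    is never met. *)
Lemma connect_avoiding r x z :
  z != x -> d r z <= d r x ->
  connect (fun a b => [&& adj a b, a != x & b != x]) z r.
Proof.
move: {2}(d r z) (leqnn (d r z)) => n; elim: n z => [|n IH] z.
  by rewrite leqn0 => /eqP/(dist_eq0 dT)<- _ _; apply: connect0.
have [<- *|rz] := eqVneq r z; first exact: connect0.
have [y zy drz] := dist_pred dT rz => dn zx dx.
have yx : y != x by apply: contraTneq dx => <-; lia.
apply: (connect_trans (y := y)); first by apply: connect1; rewrite zy zx yx.
by apply: IH => //; lia.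
Qed.

(** Two neighbours no farther from [r] than [x] would both reach [r] while avoiding [x], hence
    coincide: there is only one way back towards [r]. *)
Lemma dist_next r x z z' :
  adj x z -> adj x z' -> z != z' -> d r z <= d r x -> d r z' = (d r x).+1.
Proof.
move=> xz xz' zz' dz.
have up : d r z' <= (d r x).+1.
  by have := dist_triangle dT r x z'; rewrite (dist_adj dT xz'); lia.
apply/eqP; rewrite eqn_leq up ltnNge; apply: contra zz' => dz'; apply/eqP.
have neq y : adj x y -> y != x by apply: contraTneq => ->; rewrite adj_irrefl.
apply: (acyclic_connect_neighbours xz xz').
apply: connect_trans (connect_avoiding (neq _ xz) dz) _.
rewrite sym_connect_sym ?connect_avoiding ?neq // => a b.
by rewrite adj_sym; case: (adj b a) => //=; rewrite andbC.
Qed.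

(** Once a geodesic takes a step away from [u], so does each later step, because the only way back
    is the vertex it came from. *)
Lemma dist_outward u v z s :
  adj v z -> d u z = (d u v).+1 -> d v s = (d z s).+1 ->
  d u s = d u v + d v s.
Proof.
move: {2}(d z s) (erefl (d z s)) => n; elim: n v z => [|n IH] v z dzs vz duz dvs.
  by rewrite dvs dzs -(dist_eq0 dT dzs) duz addn1.
have sz : s != z by apply/eqP=> sz; rewrite sz (distxx dT) in dzs.
have [y zy dy] := dist_pred dT sz; rewrite !(dist_sym dT s) in dy.
have vy : v != y by apply/eqP=> vy; rewrite vy in dvs; lia.
have duy : d u y = (d u z).+1 by apply: (@dist_next u z v); rewrite // 1?adj_sym //; lia.
by have := IH z y; rewrite duz dvs dy => ->; lia.
Qed.

(** The geodesic from [v] to [s] leaves through a neighbour of [v] that cannot begin both the way to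
    [u] and the way to [w]. *)
Lemma between_or u v w s :
  u != v -> w != v -> d u w = d u v + d v w ->
  d u s = d u v + d v s \/ d w s = d w v + d v s.
Proof.
move=> uv wv duw.
have [<-|sv] := eqVneq s v; first by left; rewrite (distxx dT) addn0.
have [a va da] := dist_pred dT uv; have [b vb db] := dist_pred dT wv.
have [z vz dz] := dist_pred dT sv.
have ab : a != b.
  apply/eqP=> ab; have := dist_triangle dT u a w.
  by rewrite {2}ab (dist_sym dT b) duw da (dist_sym dT v) db; lia.
rewrite !(dist_sym dT s) in dz.
have [az|az] := eqVneq a z.
  right; apply: (dist_outward vz _ dz).
  by apply: (dist_next vb vz); rewrite ?db // -az eq_sym.
by left; apply: (dist_outward vz _ dz); apply: (dist_next va vz); rewrite ?da.
Qed.

(** Geodesics in a tree are unique: [x] is moved back to its only neighbour nearer to [r] until it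
    reaches [b]. *)
Lemma between_chain r x a b :
  d r x = d r a + d a x -> d r x = d r b + d b x -> d r a <= d r b ->
  d r b = d r a + d a b.
Proof.
move: {2}(d b x) (erefl (d b x)) => n.
elim: n x => [|n IH] x dbx dra drb ab.
  by move: dbx dra => /(dist_eq0 dT)<-.
have bx : b != x by apply/eqP=> bx; rewrite bx (distxx dT) in dbx.
have ax : a != x by apply/eqP=> ax; rewrite ax (distxx dT) in dra; rewrite ax in ab; lia.
have [y xy dy] := dist_pred dT ax; have [z xz dz] := dist_pred dT bx.
have ty := dist_triangle dT r a y; have tz := dist_triangle dT r b z.
have [yz|yz] := eqVneq y z.
  have := dist_triangle dT r y x; rewrite (dist_sym dT y) (dist_adj dT xy) => tx.
  by apply: (IH y) => //; rewrite ?yz; rewrite -?yz in tz dz *; lia.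
by have := @dist_next r x y z xy xz yz; lia.
Qed.

(** Among the vertices that [a] separates from [r], one farthest from [r] is a leaf, since a second
    neighbour would be farther still. *)
Lemma leaf_beyond r a : r != a ->
  exists2 x, degree x = 1 & d r x = d r a + d a x.
Proof.
move=> ra; have Pa : d r a == d r a + d a a by rewrite (distxx dT) addn0.
case: (arg_maxnP (P := fun x => d r x == d r a + d a x) (d r) Pa) => x /eqP dx mx.
exists x => //.
have rx : r != x.
  apply/eqP=> rx; move: dx; rewrite -rx (distxx dT).
  by have := dist_gt0 dT ra; lia.
have [z xz dz] := dist_pred dT rx.
apply/eqP/cards1P; exists z; apply/setP=> y; rewrite !inE.
apply/idP/eqP=> [xy|->//]; apply/eqP; apply: contraT => yz.
have dy : d r y = (d r x).+1 by apply: (dist_next xz xy); rewrite 1?eq_sym // dz.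
have : d r y == d r a + d a y.
  have := dist_triangle dT r a y; have := dist_triangle dT a x y.
  by rewrite (dist_adj dT xy); lia.
by move/mx; lia.
Qed.

(** Every point is sent to a leaf beyond it as seen from a fixed point [r] of [A], and [r] itself as
    seen from a second point [r']. This map is injective. *)
Lemma general_position_tree (A : {set T}) :
  1 < #|A| -> general_position A -> #|A| <= num_leaves T.
Proof.
move=> A1 /(general_positionP dT) gp.
have [r [r' [rA r'A rr']]] := card_gt1P A1.
have leafP a : exists x, a \in A ->
    degree x = 1 /\ let s := if a == r then r' else r in d s x = d s a + d a x.
  case: (boolP (a \in A)) => [aA|_]; last by exists r.
  have sa : (if a == r then r' else r) != a.
    by case: (eqVneq a r) => [->|]; rewrite eq_sym.
  by have [x lx dx] := leaf_beyond sa; exists x.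
have {leafP}[f fP] := choice leafP.
rewrite -(card_in_imset (f := f)).
  apply: subset_leq_card; apply/subsetP=> _ /imsetP[a /fP[lx _] ->].
  by rewrite inE lx.
have main a b : a \in A -> b \in A -> a != r -> b != r -> f a = f b ->
    d r a <= d r b -> a = b.
  move=> aA bA ar br fab ab; have [_] := fP a aA; have [_] := fP b bA.
  rewrite /= (negbTE ar) (negbTE br) fab => db da.
  apply/eqP; apply: contraT => nab; case: (gp r a b) => //.
    by rewrite /= !inE negb_or eq_sym ar eq_sym br nab.
  exact: between_chain da db ab.
(* Here [r] lies between [r'] and the common leaf, and [a] between [r] and that leaf, so [r] lies
   between [r'] and [a]. For [a = r'] the two equations contradict each other. *)
have mainr a : a \in A -> a != r -> f a = f r -> False.
  move=> aA ar far; have [_] := fP a aA; have [_] := fP r rA.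
  rewrite /= (negbTE ar) eqxx far => dr da.
  have drr' := dist_gt0 dT rr'.
  have [ar'|ar'] := eqVneq a r'; first by move: da; rewrite ar'; lia.
  apply: (gp r' r a) => //.
    by rewrite /= !inE negb_or eq_sym rr' eq_sym ar' eq_sym ar.
  by have := dist_triangle dT r' r a; have := dist_triangle dT r' a (f r); lia.
move=> a b aA bA fab.
have [ar|ar] := eqVneq a r; have [br|br] := eqVneq b r.
- by rewrite ar br.
- by case: (mainr b) => //; rewrite -ar.
- by case: (mainr a) => //; rewrite -br.
by case/orP: (leq_total (d r a) (d r b)) => /main h; [|symmetry]; apply: h.
Qed.

End Tree.

(** * Distance in the prism *)

Definition prism_dist (T : sgraph) (n : nat) (d : T -> T -> nat)
  (u v : cartesian T (complete n)) := d u.1 v.1 + (u.2 != v.2).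

(** An edge changes only one of the two summands, by at most 1. The bound is attained by walking
    inside one layer and changing layer, if necessary, at the end. *)
Lemma prism_is_dist (T : sgraph) (n : nat) (d : T -> T -> nat) :
  is_dist d -> is_dist (@prism_dist T n d).
Proof.
move=> dT; split=> [x p|x y].
  elim: p x => [|z p IH] x; first by rewrite /prism_dist (distxx dT) /= eqxx.
  case/andP=> xz /IH{IH}; rewrite /= /prism_dist.
  have := dist_triangle dT x.1 z.1 (last z p).1.
  case/orP: xz => /andP[].
    by move=> /(dist_adj dT)-> /eqP->;
       move: (d x.1 _) (d z.1 _) (z.2 != _) => m k e; lia.
  move=> /eqP-> _; rewrite (distxx dT).
  by move: (d z.1 _) (x.2 != _) (z.2 != _) => m e f; lia.
have [p [pp lp sp]] := dT.2 x.1 y.1.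
pose q := [seq (t, x.2) : cartesian T (complete n) | t <- p].
have lq : last x q = (y.1, x.2) by case: x @q pp lp sp => a b q _ lp _; rewrite last_map lp.
have pq : path (@adj (cartesian T (complete n))) x q.
  case: x @q pp {lp sp lq} => a b q; rewrite path_map; apply: sub_path => s t st.
  by rewrite /= /cart_adj /= st eqxx.
have [e|e] := eqVneq x.2 y.2.
  by exists q; rewrite lq size_map sp /prism_dist e eqxx addn0; case: y {lp sp lq e}.
exists (rcons q y); rewrite last_rcons size_rcons size_map sp /prism_dist e addn1.
by split=> //; rewrite rcons_path pq lq /= /cart_adj /= eqxx orbC /complete_adj e.
Qed.

Lemma ord2_neq (i j k : 'I_2) : i != j -> k != j -> i = k.
Proof.
by case: i => [[|[]]//] ?; case: j => [[|[]]//] ?; case: k => [[|[]]//] ? *;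
   apply: val_inj.
Qed.

Lemma rev_ord2_neq (i : 'I_2) : rev_ord i != i.
Proof. by case: i => [[|[]]]. Qed.

(** * Upper bound: hubs and the invariance of their layer *)

Section Prism.
Variables (T : sgraph) (d : T -> T -> nat).
Hypotheses (dT : is_dist d) (acT : acyclic T).
Local Notation G := (cartesian T (complete 2)).
Local Notation D := (@prism_dist T 2 d).
Implicit Types (S A B : {set G}) (u v w s a b c : G) (i j : 'I_2).

(** The index is the layer rather than the robot [v], since the vertex of the lone robot may change
    under moves while its layer persists. *)
Definition hub i S := exists u v w,
  [/\ [/\ u \in S, v \in S & w \in S],
      [/\ u.1 != v.1, w.1 != v.1 & d u.1 w.1 = d u.1 v.1 + d v.1 w.1],
      v.2 = i & forall s, s \in S -> s != v -> s.2 != i].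

(** With only two layers, a third robot shares the layer of one of two robots over the same tree
    vertex; that one then lies between it and the other. *)
Lemma prism_fst_inj S : general_position S -> 2 < #|S| ->
  {in S &, injective (@fst T (complete 2))}.
Proof.
move=> /(general_positionP (prism_is_dist 2 dT)) gp S3 u v uS vS uv1.
apply/eqP; apply: contraT => uv.
have /card_gt0P[w] : 0 < #|S :\: [set u; v]|.
  by rewrite cardsD subn_gt0 (leq_ltn_trans (subset_leq_card (subsetIr _ _))) //
     cards2 uv.
rewrite !inE negb_or => /andP[/andP[wu wv] wS].
have uv2 : u.2 != v.2.
  apply: contra uv => /eqP uv2; apply/eqP.
  by case: u v uv1 uv2 {uS vS wu wv} => ? ? [? ?] /= -> ->.
have [wu2|wu2] := eqVneq w.2 u.2.
  case: (gp w u v) => //; first by rewrite /= !inE negb_or wu wv uv.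
  by rewrite /prism_dist wu2 eqxx uv1 (distxx dT) uv2 addn0.
have wv2 : w.2 = v.2 by apply: ord2_neq wu2 _; rewrite eq_sym.
case: (gp w v u) => //; first by rewrite /= !inE negb_or wu wv eq_sym uv.
by rewrite /prism_dist wv2 eqxx uv1 (distxx dT) eq_sym uv2 addn0.
Qed.

Lemma large_general_position_hub S :
  general_position S -> 2 < #|S| -> num_leaves T < #|S| -> exists i, hub i S.
Proof.
move=> gpS S3 Sl; have inj := prism_fst_inj gpS S3.
have /(general_positionP (prism_is_dist 2 dT)) gp := gpS.
have : ~ general_position [set u.1 | u in S].
  move=> /(general_position_tree dT acT).
  by rewrite card_in_imset // => /(_ (ltnW S3)); rewrite leqNgt Sl.
move=> ngp; apply: contrapT => nhub; apply/ngp/(general_positionP dT).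
move=> _ _ _ /imsetP[u uS ->] /imsetP[v vS ->] /imsetP[w wS ->] uq duw.
move: uq; rewrite /= !inE negb_or andbT => /andP[/andP[uv uw] vw].
have wv : w.1 != v.1 by rewrite eq_sym.
apply: nhub; exists v.2, u, v, w; split=> //.
move=> s sS sv; apply/eqP=> sv2.
have sv1 : s.1 != v.1 by apply: contra sv => /eqP/inj->.
(* As [s] and [v] share a layer, [D a s] and [D a v] have the same layer term and [D v s] has none,
   so betweenness lifts from the tree to the prism. *)
have key a : a \in S -> a.1 != v.1 -> d a.1 s.1 = d a.1 v.1 + d v.1 s.1 -> False.
  move=> aS av1 das; apply: (gp a v s) => //; last first.
    by rewrite /prism_dist das sv2 eqxx addn0 addnAC.
  have av : a != v by apply: contra av1 => /eqP->.
  have asn : a != s.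
    by rewrite eq_sym in sv1; apply: contra (between_neq dT sv1 das) => /eqP->.
  by rewrite /= !inE negb_or av asn eq_sym sv.
have [h|h] := between_or dT acT s.1 uv wv duw; [exact: key h | exact: key h].
Qed.

Lemma hub_legal_move i j A B : legal_move A B -> hub i A -> hub j B -> i = j.
Proof.
move=> [p [q [pA pq qA defB _]]] [u [v [w [[uA vA wA] [uv wv duw] vi Ai]]]].
move=> [a [b [c [[aB bB cB] [ab cb dac] bj Bj]]]].
(* All of [A] but [v] lies in layer [j], and all of [B] but [b] in layer [i]. A single move allows
   this only if [u], [w] are [p], [b] and [a], [c] are [q], [v], in some order. Over the common
   vertex [p.1 = q.1], each of [v] and [b] then lies between that vertex and the other, which forces
   [v.1 = b.1]. *)
apply/eqP; apply: contraT => ij.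
have neq (x y : G) : x.1 != y.1 -> x != y by apply: contra => /eqP->.
have ac : a.1 != c.1.
  by apply: (between_neq dT) dac; rewrite eq_sym.
have uw : u.1 != w.1.
  by apply: (between_neq dT) duw; rewrite eq_sym.
have inB x : x \in B -> x = q \/ x \in A.
  by rewrite defB !inE => /orP[/eqP->|/andP[_ ->]]; [left|right].
have inA x : x \in A -> x = p \/ x \in B.
  by move=> xA; rewrite defB !inE xA andbT; case: (eqVneq x p) => [->|_]; [left|right; rewrite orbT].
have Bq x : x \in B -> x.1 != b.1 -> x.2 = i /\ (x = q \/ x = v).
  move=> xB xb; have xi : x.2 = i by apply: ord2_neq ij; rewrite Bj ?neq.
  split=> //; case: (inB x xB) => [|xA]; first by left.
  by right; apply/eqP; apply: contraT => /(Ai x xA); rewrite xi eqxx.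
have Ap x : x \in A -> x.1 != v.1 -> x.2 = j /\ (x = p \/ x = b).
  move=> xA xv; have xj : x.2 = j.
    by apply: (@ord2_neq _ i); [apply: Ai; rewrite ?neq | rewrite eq_sym].
  split=> //; case: (inA x xA) => [|xB]; first by left.
  by right; apply/eqP; apply: contraT => /(Bj x xB); rewrite xj eqxx.
have [ai aq] := Bq a aB ab; have [ci cq] := Bq c cB cb.
have [uj up] := Ap u uA uv; have [wj wp] := Ap w wA wv.
have qi : q.2 = i by case: aq cq ai ci ac => [-> //|->] [-> //|->]; rewrite eqxx.
have pj : p.2 = j by case: up wp uj wj uw => [-> //|->] [-> //|->]; rewrite eqxx.
(* The move changes layer, so its edge is a rung of the prism. *)
have pq1 : p.1 = q.1.
  by move: pq; rewrite /= /cart_adj qi pj eq_sym (negbTE ij) andbF => /andP[/eqP].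
have h1 : d p.1 b.1 = d p.1 v.1 + d v.1 b.1.
  case: up wp uw duw => [->|->] [->|->]; rewrite ?eqxx // => _.
  by rewrite (dist_sym dT b.1) (dist_sym dT b.1 v.1) (dist_sym dT v.1 p.1) addnC.
have h2 : d p.1 v.1 = d p.1 b.1 + d b.1 v.1.
  rewrite pq1; case: aq cq ac dac => [->|->] [->|->]; rewrite ?eqxx // => _.
  by rewrite (dist_sym dT v.1) (dist_sym dT v.1 b.1) (dist_sym dT b.1 q.1) addnC.
have vb : v.1 != b.1.
  by case: aq cq ab cb ac => [->|->] [->|->]; rewrite ?eqxx.
by rewrite (between_antisym dT h1 h2) eqxx in vb.
Qed.

Lemma legal_move_card A B : legal_move A B -> #|B| = #|A|.
Proof.
move=> [p [q [pA pq qA -> _]]].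
by rewrite cardsU1 !inE (negbTE qA) andbF (cardsD1 p A) pA.
Qed.

Lemma hub_alone_not_leaf i S s :
  hub i S -> s \in S -> s.2 = i -> degree s.1 <> 1.
Proof.
move=> [u [v [w [[uS vS wS] [uv wv duw] vi Si]]]] sS si ls.
have sv : s = v by apply/eqP; apply: contraT => /(Si s sS); rewrite si eqxx.
rewrite sv in ls; case: (leaf_not_between dT ls duw) => e.
  by rewrite e eqxx in uv.
by rewrite e eqxx in wv.
Qed.

Lemma mobile_card_le S :
  1 < num_leaves T -> mobile S -> #|S| <= num_leaves T.
Proof.
move=> l1 [gpS [Ss [pSs cov]]]; rewrite leqNgt; apply/negP => Sl.
have [i hS] := large_general_position_hub gpS (leq_ltn_trans l1 Sl) Sl.
(* Moves preserve the number of robots, so each later configuration is again too large and has a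
   hub, in the layer of the preceding one. *)
have hAll A : A \in S :: Ss -> hub i A.
  elim: Ss S {gpS cov} pSs Sl hS => [|B Ss IH] S /=.
    by move=> _ _ hS; rewrite inE => /eqP->.
  move=> /andP[/asboolP mv pSs] Sl hS; rewrite inE => /orP[/eqP->//|].
  have Bl : num_leaves T < #|B| by rewrite (legal_move_card mv).
  have gpB : general_position B by case: mv => [? [? []]].
  have [j hB] := large_general_position_hub gpB (leq_ltn_trans l1 Bl) Bl.
  by apply: IH => //; rewrite (hub_legal_move mv hS hB).
have /card_gt0P[x] := ltnW l1; rewrite inE => /eqP lx.
have [A /hAll hA xA] := cov (x, i).
exact: (hub_alone_not_leaf hA xA).
Qed.

End Prism.

(** * Reversible moves and closed tours *)

Section Mobility.
Variable G : sgraph.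
Implicit Types S A B R : {set G}.

(** General position of the source is added to make the relation symmetric; [legal_move] demands it
    of the target only. *)
Definition reversible_move : rel {set G} :=
  fun A B => `[< general_position A /\ legal_move A B >].

Lemma reversible_move_sym : symmetric reversible_move.
Proof.
suff imp A B : reversible_move A B -> reversible_move B A.
  by move=> A B; apply/idP/idP; apply: imp.
move=> /asboolP[gpA [u [v [uA uv vA -> gpB]]]]; apply/asboolP; split=> //.
have neq_uv : u != v by apply: contraNneq vA => <-.
exists v, u; split=> //; rewrite ?setU11 1?adj_sym //.
  by rewrite !inE negb_or neq_uv eqxx.
by rewrite setU1K ?setD1K // !inE (negbTE vA) andbF.
Qed.

Lemma reversible_move_swap u v R :
  u \notin R -> v \notin R -> adj u v ->
  general_position (u |: R) -> general_position (v |: R) ->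
  reversible_move (u |: R) (v |: R).
Proof.
move=> uR vR uv gpu gpv; apply/asboolP; split=> //.
exists u, v; split; rewrite ?setU11 ?setU1K // !inE negb_or vR andbT.
by apply: contraTneq uv => ->; rewrite adj_irrefl.
Qed.

(* Moves are reversible, so the robots can return to [S] between two visits. *)
Lemma connect_mobile S :
  general_position S ->
  (forall x, exists2 A, connect reversible_move S A & x \in A) -> mobile S.
Proof.
move=> gpS reach; split=> //.
suff [Ss [pS _ cov]] : exists Ss, [/\ path reversible_move S Ss, last S Ss = S &
    forall x, x \in enum G -> exists2 A, A \in S :: Ss & x \in A].
  exists Ss; split; last by move=> x; apply: cov; rewrite mem_enum.
  by apply: sub_path pS => A B /asboolP[_ mv]; apply/asboolP.
elim: (enum G) => [|x s [Ss [pS lS cov]]]; first by exists [::].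
have [A SA xA] := reach x.
have /connectP[q pq lq] : connect reversible_move A S.
  by rewrite (sym_connect_sym reversible_move_sym).
have [p pp lp] := connectP SA.
exists (Ss ++ p ++ q); split.
- by rewrite !cat_path pS lS pp -lp.
- by rewrite !last_cat lS -lp.
move=> y; rewrite inE => /orP[/eqP->|/cov[B BS yB]].
  exists A => //; have := mem_last S p.
  by rewrite -lp !inE !mem_cat => /orP[|] ->; rewrite ?orbT.
by exists B => //; rewrite -cat_cons mem_cat BS.
Qed.

End Mobility.

(** * Lower bound: robots on the leaves *)

Section LeafConfigurations.
Variables (T : sgraph) (d : T -> T -> nat).
Hypothesis dT : is_dist d.
Local Notation G := (cartesian T (complete 2)).
Local Notation D := (@prism_dist T 2 d).
Implicit Types (S : {set G}) (u v w s : G) (i j : 'I_2) (f g h : T -> 'I_2).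
Implicit Types x y z t : T.

(** If [u] and [w] are both outside the layer of [v], they share the other layer, so a detour
    through [v] costs two layer changes. *)
Lemma prism_between u v w : D u w = D u v + D v w ->
  d u.1 w.1 = d u.1 v.1 + d v.1 w.1 /\ (u.2 != v.2 -> w.2 != v.2 -> False).
Proof.
have := dist_triangle dT u.1 v.1 w.1; rewrite /prism_dist.
move: (d _ _) (d _ _) (d _ _) => m k l.
have [uv|uv] := eqVneq u.2 v.2; have [wv|wv] := eqVneq w.2 v.2.
- by rewrite uv wv eqxx; split=> //; lia.
- by rewrite uv eq_sym wv; split=> //; lia.
- by rewrite wv uv; split=> //; lia.
by rewrite (ord2_neq uv wv) eqxx; lia.
Qed.

Lemma general_position_leaves S :
  {in S &, injective (@fst T (complete 2))} ->
  (forall v, v \in S -> degree v.1 = 1 \/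
     forall s, s \in S -> s != v -> s.2 != v.2) ->
  general_position S.
Proof.
move=> inj lone; apply/(general_positionP (prism_is_dist 2 dT)).
move=> u v w uS vS wS; rewrite /= !inE negb_or andbT => /andP[/andP[uv uw] vw].
move=> /prism_between[duw lay]; case: (lone v vS) => [lv|lv].
  case: (leaf_not_between dT lv duw) => /inj e.
    by rewrite e ?eqxx in uv.
  by rewrite e ?eqxx in vw.
by apply: lay; apply: lv => //; rewrite eq_sym.
Qed.

Definition leaves_at f : {set G} :=
  [set v : G | (degree v.1 == 1) && (v.2 == f v.1)].

Definition leaves_except x i : {set G} :=
  [set v : G | [&& degree v.1 == 1, v.1 != x & v.2 == i]].

(** Here [i] is the layer of the waiting robots; the robot that belongs to the leaf [x] stands over
    [t], alone in the opposite layer. *)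
Definition roaming x t i : {set G} := ((t, rev_ord i) : G) |: leaves_except x i.

Lemma general_position_leaves_at f : general_position (leaves_at f).
Proof.
apply: general_position_leaves => [[x i] [y j]|v]; rewrite !inE /=.
  by move=> /andP[_ /eqP->] /andP[_ /eqP->] ->.
by move=> /andP[/eqP]; left.
Qed.

(** The condition on [t] keeps the roaming robot from projecting onto a waiting one; being alone in
    its layer, it lies between no two of them. *)
Lemma general_position_roaming x t i :
  t = x \/ degree t <> 1 ->
  general_position (roaming x t i).
Proof.
move=> tx.
have nt y : degree y == 1 -> y != x -> y <> t.
  by move=> /eqP ly yx yt; case: tx => [e|]; [rewrite yt e eqxx in yx | rewrite -yt].
apply: general_position_leaves => [[y j] [z k]|[y j]]; rewrite !inE.
  move=> /orP[/eqP[-> ->]|/and3P[/= ly yx /eqP->]];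
  move=> /orP[/eqP[-> ->]|/and3P[/= lz zx /eqP->]] //= e.
  - by case: (nt z).
  - by case: (nt y).
  - by rewrite e.
move=> /orP[/eqP[-> ->]|/and3P[/eqP ly _ _]]; last by left.
right=> s; rewrite !inE => /orP[->//|/and3P[_ _ /eqP->] _].
by rewrite eq_sym rev_ord2_neq.
Qed.

(** Either the two configurations are equal, or the robot over the leaf [x] crosses to the other
    layer while the robots in [R] stay. *)
Lemma connect_leaves_at1 x g h :
  (forall y, y != x -> h y = g y) ->
  connect (@reversible_move G) (leaves_at g) (leaves_at h).
Proof.
move=> gh; have [e|e] := eqVneq (g x) (h x).
  rewrite (_ : leaves_at h = leaves_at g) ?connect0 //.
  apply/setP=> v; rewrite !inE.
  by have [->|/gh->] := eqVneq v.1 x; rewrite ?e.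
have [lx|lx] := boolP (degree x == 1); last first.
  rewrite (_ : leaves_at h = leaves_at g) ?connect0 //.
  apply/setP=> v; rewrite !inE.
  by have [->|/gh->] := eqVneq v.1 x; rewrite ?(negbTE lx).
pose R := [set v : G | [&& degree v.1 == 1, v.1 != x & v.2 == g v.1]].
have defL k : (forall y, y != x -> k y = g y) -> leaves_at k = ((x, k x) : G) |: R.
  move=> kg; apply/setP=> -[y j]; rewrite !inE xpair_eqE /=.
  have [->|yx] := eqVneq y x; first by rewrite lx andbF orbF.
  by rewrite kg.
apply: connect1; have := @general_position_leaves_at g.
have := @general_position_leaves_at h; rewrite !defL // => gph gpg.
apply: reversible_move_swap; rewrite ?inE /= ?eqxx ?andbF //.
by rewrite /cart_adj /= eqxx /complete_adj e orbT.
Qed.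

Lemma connect_leaves_at f g :
  connect (@reversible_move G) (leaves_at f) (leaves_at g).
Proof.
(* The list [s] holds the vertices already switched from [f] to [g]. *)
have step (s : seq T) : connect (@reversible_move G) (leaves_at f)
    (leaves_at (fun y => if y \in s then g y else f y)).
  elim: s => [|x s IH]; first exact: connect0.
  apply: connect_trans IH _; apply: (@connect_leaves_at1 x) => y yx.
  by rewrite inE (negbTE yx).
suff -> : leaves_at g = leaves_at (fun y => if y \in enum T then g y else f y).
  exact: step.
by apply/setP=> v; rewrite !inE mem_enum.
Qed.

Lemma connect_roaming x t i :
  degree x = 1 -> t = x \/ degree t <> 1 ->
  connect (@reversible_move G) (leaves_at (fun=> i)) (roaming x t i).
Proof.
(* Induction on the distance of the roaming robot from its leaf [x]. At [x] itself the configuration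
   has every robot over a leaf, with only that of [x] in the other layer. *)
move=> lx; move: {2}(d x t) (erefl (d x t)) => n; elim: n t => [|n IH] t dt.
  rewrite -(dist_eq0 dT dt) => _.
  rewrite (_ : roaming x x i = leaves_at (fun y => if y == x then rev_ord i else i)).
    exact: connect_leaves_at.
  apply/setP=> -[y j]; rewrite !inE xpair_eqE /=.
  by have [->|yx] := eqVneq y x; rewrite ?lx ?eqxx ?andbF ?orbF.
have xt : x != t by apply/eqP=> e; rewrite e (distxx dT) in dt.
case=> [e|lt]; first by rewrite e eqxx in xt.
have [z tz dz] := dist_pred dT xt.
(* The preceding vertex lies between [x] and [t], so the only leaf it can be is [x]. *)
have zP : z = x \/ degree z <> 1.
  have [lz|] := eqVneq (degree z) 1; last by move/eqP; right.
  have : d x t = d x z + d z t by rewrite dz (dist_sym dT z) (dist_adj dT tz) addn1.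
  case/(leaf_not_between dT lz) => e; first by left.
  by rewrite e adj_irrefl in tz.
apply: connect_trans (IH z _ zP) (connect1 _); first by apply/succn_inj; rewrite -dz.
have notR y : (y, rev_ord i) \notin leaves_except x i.
  by rewrite inE /= (negbTE (rev_ord2_neq i)) !andbF.
apply: reversible_move_swap => //; rewrite ?notR //.
- by rewrite /= /cart_adj /= adj_sym tz eqxx.
- exact: general_position_roaming.
by apply: general_position_roaming; right.
Qed.

Lemma mobile_leaves : 0 < num_leaves T -> mobile (leaves_at (fun=> ord0)).
Proof.
move=> /card_gt0P[x]; rewrite inE => /eqP lx.
apply: connect_mobile => [|[t i]]; first exact: general_position_leaves_at.
have [lt|/eqP lt] := eqVneq (degree t) 1.
  exists (leaves_at (fun=> i)); first exact: connect_leaves_at.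
  by rewrite inE /= lt !eqxx.
(* The others wait in layer [rev_ord i], so that the robot over the inner vertex [t] is in layer
   [i]. *)
exists (roaming x t (rev_ord i)).
  apply: connect_trans (connect_roaming _ lx (or_intror lt)).
  exact: connect_leaves_at.
by rewrite /roaming rev_ordK setU11.
Qed.

Lemma card_leaves_at i : #|leaves_at (fun=> i)| = num_leaves T.
Proof.
rewrite /num_leaves -(card_imset (f := fun x => (x, i) : G)); last by move=> x y [].
apply: eq_card => -[x j]; rewrite !inE /=.
apply/andP/imsetP => [[lx /eqP->]|[y]]; first by exists x; rewrite ?inE.
by rewrite inE => ly [-> ->].
Qed.

End LeafConfigurations.

Theorem theorem3p1 (T : sgraph) (treeT : is_tree T) (orderT : 3 <= #|T|) :
  mob (cartesian T (complete 2)) = num_leaves T.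
Proof.
case: treeT => cT acT; have [d dT] := connected_is_dist cT.
(* Two distinct vertices are vacuously in general position, so the bound for trees already provides
   two leaves. *)
have leaves2 : 1 < num_leaves T.
  have [x [y [_ _ xy]]] : exists x y : T, [/\ x \in T, y \in T & x != y].
    by apply/card_gt1P; apply: ltnW.
  have card2 : #|[set x; y]| = 2 by rewrite cards2 xy.
  rewrite -card2; apply: (general_position_tree dT acT); first by rewrite card2.
  move=> u v w; rewrite !inE => uP vP wP uq _; move: uq.
  by case/orP: uP => /eqP->; case/orP: vP => /eqP->; case/orP: wP => /eqP->;
     rewrite /= !inE !eqxx ?orbT ?andbF.
apply/eqP; rewrite eqn_leq; apply/andP; split.
  apply/bigmax_leqP => S /asboolP mS; exact: (mobile_card_le dT acT).
rewrite -(card_leaves_at T ord0); apply: (bigmax_sup (leaves_at (fun=> ord0))) => //.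
by apply/asboolP; apply: (mobile_leaves dT); apply: ltnW.
Qed.
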